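(* Let $X$ be a continuum. If $\mathcal{T}\colon 2^{X}\to 2^{X}$ is continuous, then $X$ is both $\mathcal{T}$-symmetric and $\mathcal{T}$-additive.
   Context: A continuum is a compact, connected, nonempty metric space; a subcontinuum of $X$ is a subset of $X$ that is a continuum. For a continuum $X$, $2^X$ denotes the set of all nonempty closed subsets of $X$ with the Hausdorff metric. Jones' set function $\mathcal{T}$ is defined for every $A\subseteq X$ by $$\mathcal{T}(A)=X\setminus\{x\in X : \text{there is a subcontinuum } W \text{ of } X \text{ with } x\in W^{\circ}\subseteq W\subseteq X\setminus A\},$$ where $W^\circ$ is the interior of $W$ in $X$. If $A\in 2^X$ then $\mathcal{T}(A)\in 2^X$, and continuity of $\mathcal{T}$ refers to its restriction $2^X\to 2^X$. $X$ is $\mathcal{T}$-additive if $\mathcal{T}(A\cup B)=\mathcal{T}(A)\cup\mathcal{T}(B)$ for each pair of closed subsets $A,B$ of $X$. $X$ is $\mathcal{T}$-symmetric if for all closed subsets $A,B$ of $X$: $A\cap\mathcal{T}(B)=\emptyset$ if and only if $\mathcal{T}(A)\cap B=\emptyset$. *)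

(* Defs.v *)
From HB Require Import structures.
From mathcomp Require Import all_boot all_order all_algebra.
From mathcomp Require Import all_classical all_reals all_analysis.
From mathcomp Require Import lra.

Set Implicit Arguments.
Unset Strict Implicit.
Unset Printing Implicit Defensive.

Import Order.TTheory GRing.Theory Num.Theory.
Import numFieldTopology.Exports.

Local Open Scope classical_set_scope.
Local Open Scope ring_scope.

(* [connected set0] and [compact set0] hold in the library, hence the
   explicit nonemptiness. A metric space X is a continuum when
   [continuum [set: X]]; a subcontinuum of X is a set W with [continuum W]. *)
Definition continuum (R : realType) (X : metricType R) (W : set X) : Prop :=
  [/\ compact W, connected W & W !=set0].

Definition jonesT (R : realType) (X : metricType R) (A : set X) : set X :=
  ~` [set x | exists W : set X,
        [/\ continuum W, (W°) x & W `<=` ~` A]].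

Definition T_additive (R : realType) (X : metricType R) : Prop :=
  forall A B : set X, closed A -> closed B ->
    jonesT (A `|` B) = jonesT A `|` jonesT B.

Definition T_symmetric (R : realType) (X : metricType R) : Prop :=
  forall A B : set X, closed A -> closed B ->
    (A `&` jonesT B = set0 <-> jonesT A `&` B = set0).

(* The hyperspace 2^X. It carries the proof that X is a continuum because the
   Hausdorff distance below is a (finite) metric only when X is bounded. *)
Record hyperspace (R : realType) (X : metricType R)
    (cX : continuum [set: X]) := Hyperspace {
  hset :> set X ;
  hset_closed : closed hset ;
  hset_neq0 : hset !=set0
}.

Arguments hset_closed {R X cX} h.
Arguments hset_neq0 {R X cX} h.

Definition set_nbhd (R : realType) (X : metricType R) (e : R) (A : set X) :
    set X :=
  \bigcup_(a in A) ball a e.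

Definition hausdorff_dist (R : realType) (X : metricType R) (A B : set X) : R :=
  inf [set e | [/\ 0 < e, A `<=` set_nbhd e B & B `<=` set_nbhd e A]].

Section hyperspace_metric.
Context (R : realType) (X : metricType R) (cX : continuum [set: X]).
Implicit Types (A B C : hyperspace cX) (e : R).

Local Notation hradii A B :=
  [set e : R | [/\ 0 < e, A `<=` set_nbhd e B & B `<=` set_nbhd e A]].

Lemma hyperspace_eq A B : hset A = hset B -> A = B.
Proof.
case: A B => [A cA A0] [B cB B0] /= AB; subst B.
by rewrite (Prop_irrelevance cA cB) (Prop_irrelevance A0 B0).
Qed.

Lemma continuum_bounded : exists2 M : R, 0 < M & forall x y : X, ball x M y.
Proof.
have [cpt _ [x0 _]] := cX.
have : \forall i \near +oo, [set: X] `<=` [set x | ball x0 i x].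
  apply: (proj1 (compact_near_coveringP _) cpt) => x _.
  exists (ball x 1, [set i : R | mdist x0 x + 1 < i]) => /=.
    split; first exact: nbhsx_ballx.
    by exists (mdist x0 x + 1); split => //; exact: num_real.
  move=> [y i] /= [xy xi]; move: xy; rewrite !ballEmdist /= => xy.
  by have := metric_triangle x0 x y; lra.
case=> M [_ MP]; pose N := Num.max M 0 + 1.
have N0 : 0 < N by rewrite /N ltr_pwDr // le_max lexx orbT.
have NP x : ball x0 N x.
  by apply: (MP N) => //; rewrite /N ltr_pwDr // le_max lexx.
by exists (N + N) => [|x y]; [lra | exact: ball_triangle (ball_sym (NP x)) (NP y)].
Qed.

Lemma hradii_has_inf A B : has_inf (hradii A B).
Proof.
split; last by exists 0 => e [/ltW].
have [M M0 MP] := continuum_bounded.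
have [a Aa] := hset_neq0 A; have [b Bb] := hset_neq0 B.
by exists M; split => // x _; [exists b|exists a].
Qed.

Lemma hausdorff_dist_ge0 A B : 0 <= hausdorff_dist A B.
Proof. by apply: lb_le_inf; [case: (hradii_has_inf A B)|move=> e [/ltW]]. Qed.

Lemma hausdorff_dist_lt A B e : hausdorff_dist A B < e ->
  exists2 d, d < e & [/\ 0 < d, A `<=` set_nbhd d B & B `<=` set_nbhd d A].
Proof.
move=> ABe; have e0 : 0 < e - hausdorff_dist A B by rewrite subr_gt0.
have [d dP de] := inf_adherent e0 (hradii_has_inf A B).
by exists d => //; move: de; rewrite -/(hausdorff_dist A B); lra.
Qed.

Lemma hausdorff_dist_le A B e : 0 < e ->
  A `<=` set_nbhd e B -> B `<=` set_nbhd e A -> hausdorff_dist A B <= e.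
Proof. by move=> *; apply: ge_inf => //; case: (hradii_has_inf A B). Qed.

Lemma hausdorff_distxx A : hausdorff_dist A A = 0.
Proof.
apply/eqP; rewrite eq_le hausdorff_dist_ge0 andbT.
apply/ler_addgt0Pl => e e0; rewrite addr0.
by apply: hausdorff_dist_le => // x Ax; exists x => //; exact: ballxx.
Qed.

Lemma hausdorff_dist_sym A B : hausdorff_dist A B = hausdorff_dist B A.
Proof. by congr inf; apply/seteqP; split => e [? ? ?]; split. Qed.

Lemma hausdorff_dist_sub A B : hausdorff_dist A B = 0 -> hset A `<=` hset B.
Proof.
move=> AB0 x Ax; rewrite ((closure_id _).1 (hset_closed B)).
move=> V /nbhs_ballP[e /= e0 xeV].
have [|d de [d0 AB _]] := @hausdorff_dist_lt A B e; first by rewrite AB0.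
have [y By /ball_sym xy] := AB _ Ax.
by exists y; split => //; apply: xeV; exact: le_ball (ltW de) _ xy.
Qed.

Lemma hausdorff_dist_eq0 A B : hausdorff_dist A B = 0 -> A = B.
Proof.
move=> AB0; apply/hyperspace_eq/seteqP.
by split; apply: hausdorff_dist_sub; rewrite // hausdorff_dist_sym.
Qed.

Lemma set_nbhd_trans (A B C : set X) e1 e2 : A `<=` set_nbhd e1 B ->
  B `<=` set_nbhd e2 C -> A `<=` set_nbhd (e1 + e2) C.
Proof.
move=> AB BC x /AB[y /BC[z Cz zy] yx].
by exists z => //; rewrite addrC; exact: ball_triangle zy yx.
Qed.

Lemma hausdorff_dist_triangle B A C :
  hausdorff_dist A C <= hausdorff_dist A B + hausdorff_dist B C.
Proof.
apply/ler_addgt0Pl => e e0.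
have [|d1 d1e [d10 AB BA]] := @hausdorff_dist_lt A B (hausdorff_dist A B + e / 2).
  by lra.
have [|d2 d2e [d20 BC CB]] := @hausdorff_dist_lt B C (hausdorff_dist B C + e / 2).
  by lra.
apply: (@le_trans _ _ (d1 + d2)); last by lra.
apply: hausdorff_dist_le; [by lra|exact: set_nbhd_trans AB BC|].
by rewrite addrC; exact: set_nbhd_trans CB BA.
Qed.

HB.instance Definition _ := gen_eqMixin (hyperspace cX).
HB.instance Definition _ := gen_choiceMixin (hyperspace cX).
HB.instance Definition _ := @isMetric.Build R (hyperspace cX)
  (fun A B => hausdorff_dist A B) hausdorff_distxx hausdorff_dist_eq0
  hausdorff_dist_sym hausdorff_dist_triangle.

Lemma jonesT_closed (A : set X) : closed (jonesT A).
Proof.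
apply: open_closedC; rewrite openE => x [W [cW Wx WA]].
have : nbhs x W° by apply: open_nbhs_nbhs; split => //; exact: open_interior.
by apply: filterS => y Wy; exists W.
Qed.

Lemma subset_jonesT (A : set X) : A `<=` jonesT A.
Proof. by move=> x Ax [W [_ /interior_subset Wx WA]]; exact: WA Wx Ax. Qed.

Lemma jonesT_neq0 (A : set X) : A !=set0 -> jonesT A !=set0.
Proof. by move=> [x /subset_jonesT]; exists x. Qed.

(* The restriction of T to a self-map of 2^X. *)
Definition jonesT_hyperspace A : hyperspace cX :=
  Hyperspace cX (@jonesT_closed A) (jonesT_neq0 (hset_neq0 A)).

End hyperspace_metric.

Arguments jonesT_hyperspace {R X} cX A.

(* Main.v *)
Require Import Defs.
From mathcomp Require Import all_boot all_order all_algebra.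
From mathcomp Require Import all_classical all_reals all_analysis.
From mathcomp Require Import lra.

(* Write T for Jones' set function.
   If K is a continuum, a set missing the interior of K is a limit of finite
   subsets of the complement of K, so lower semicontinuity of T gives
   T(X \ int K) = X \ int K; hence T is idempotent.
   Let D be the union of the minimal sets T(x). It is closed, meets every T(x),
   and x |-> T(x) /\ D is continuous, so D is connected because X is. For b in D
   the union of D and of the T(y) with y near b is a connected neighbourhood of
   b, so that b in T(a) forces a in D. Therefore D = X, that is,
   y in T(x) <-> x in T(y).
   Next, T(A) is the union of the T(a), a in A, for finite A, by induction on the
   cardinality. If e in T({x} u A) is a counterexample, then
   T({e} u A) = T(e) u T(A) fails too, because this equation is a clopen
   condition on e outside T(A). As it is also a clopen condition on each element
   of A outside T(e), the elements of A can be moved arbitrarily close to T(e)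
   without restoring it. For the moved set A' and y near e, the component of y in
   T({y} u A') then meets the finite set A', which yields a continuum
   neighbourhood of e close to T(e), contradicting e in T({x} u A).
   By continuity T(A) is the union of the T(a) for every closed A, and symmetry
   and additivity follow. *)

Import Order.TTheory GRing.Theory Num.Theory.

Local Open Scope classical_set_scope.

(** * Finite covers, connectedness, and connected neighbourhoods *)

Section topology.
Set Implicit Arguments.
Unset Strict Implicit.
Context (X : topologicalType).
Implicit Types (A B K Q Y : set X).

Lemma sub_count_lt (T : eqType) (a b : pred T) (s : seq T) (x : T) :
  x \in s -> subpred a b -> ~~ a x -> b x -> (count a s < count b s)%N.
Proof.
move=> + ab ax bx; elim: s => // y s IH; rewrite inE => /orP[/eqP <-|/IH ?] /=.
  by rewrite (negPf ax) bx add0n add1n ltnS; exact: sub_count.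
apply: leq_ltn_trans (leq_add (n1 := b y) _ (leqnn _)) _.
  by case: (a y) (ab y) => // ->.
by rewrite ltn_add2l.
Qed.

Lemma compact_finite_cover (I : eqType) (D : set I) (f : I -> set X) K :
  compact K -> (forall x, K x -> exists2 i, D i & nbhs x (f i)) ->
  exists s : seq I, (forall i, i \in s -> D i) /\
    K `<=` \bigcup_(i in [set` s]) f i.
Proof.
move=> cK Kf.
(* Finite lists are directed by inclusion, and [F] is the filter of their tails. Compactness in its
   near-covering form then yields one list that serves all points of [K]; its entries outside [D]
   are removed at the end. *)
pose F : set_system (seq I) :=
  filter_from [set: seq I] (fun s0 => [set s : seq I | {subset s0 <= s}]).
have FF : Filter F.
  apply: filter_from_filter; first by exists [::].
  move=> s t _ _; exists (s ++ t) => // u /= stu.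
  by split => i ii; apply: stu; rewrite mem_cat ii ?orbT.
pose P (s : seq I) x := exists2 i, i \in s & D i /\ f i x.
have [] := proj1 (compact_near_coveringP K) cK _ F P FF.
  move=> x /Kf[i Di fi]; exists (f i, [set s : seq I | {subset [:: i] <= s}]) => /=.
    by split => //; exists [:: i].
  by move=> [y s] /= [fy si]; exists i => //; apply: si; rewrite mem_head.
move=> s _ /(_ s (fun _ => id)) sP.
exists [seq i <- s | `[< D i >]]; split.
  by move=> i; rewrite mem_filter => /andP[/asboolP].
move=> x /sP[i si [Di fi]]; exists i => //.
by rewrite /= mem_filter si andbT; apply/asboolP.
Qed.

Lemma connected_closedP A : closed A ->
  connected A <-> forall B C, closed B -> closed C -> A = B `|` C ->
    B `&` C = set0 -> B = set0 \/ C = set0.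
Proof.
move=> cA; split.
  move=> coA B C cB cC ABC BC0.
  have sBC : separated B C.
    by split; rewrite -?((closure_id B).1 cB) -?((closure_id C).1 cC).
  have [|AB|AC] := connected_subset sBC _ coA; first by rewrite ABC.
    right; rewrite -subset0 => x Cx; rewrite -BC0; split => //.
    by apply: AB; rewrite ABC; right.
  left; rewrite -subset0 => x Bx; rewrite -BC0; split => //.
  by apply: AC; rewrite ABC; left.
move=> h; apply: contrapT => /connectedPn[E [E0 AE [s1 s2]]].
have cE b : closed (E b).
  rewrite closure_id; apply/seteqP; split; first exact: subset_closure.
  move=> x Ex; have : A x.
    rewrite ((closure_id A).1 cA); apply: closureS x Ex.
    by rewrite AE; case: (b); [apply: subsetUr | apply: subsetUl].
  rewrite AE; case: b Ex => Ex [] // Ex'; exfalso.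
    by have : set0 x by rewrite -s2.
  by have : set0 x by rewrite -s1.
have := h _ _ (cE false) (cE true) AE.
rewrite {1}((closure_id (E false)).1 (cE false)) => /(_ s1)[] e.
  by have [x] := E0 false; rewrite e.
by have [x] := E0 true; rewrite e.
Qed.

Lemma connected_subset_clopen A B C : connected A -> closed B -> closed C ->
  A `<=` B `|` C -> B `&` C = set0 -> A `&` B !=set0 -> A `<=` B.
Proof.
move=> coA cB cC ABC BC0 [x [Ax Bx]].
have sBC : separated B C.
  by split; rewrite -?((closure_id B).1 cB) -?((closure_id C).1 cC).
have [//|AC] := connected_subset sBC ABC coA.
by exfalso; have : set0 x; [rewrite -BC0; split => //; exact: AC|].
Qed.

(* A clopen part of [Y] containing [e] and meeting as few of the [W]'s as
   possible is connected. *)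
Lemma connected_nbhs_finite Y (s : seq (set X)) (e : X) :
  closed Y -> (Y°) e ->
  (forall W, W \in s -> connected W /\ W `<=` Y) ->
  (forall Q Q', closed Q -> closed Q' -> Y = Q `|` Q' -> Q `&` Q' = set0 ->
    Q !=set0 -> exists2 W, W \in s & W `&` Q !=set0) ->
  exists K, [/\ closed K, connected K, (K°) e & K `<=` Y].
Proof.
move=> cY Ye sW meet.
pose n Q := count (fun W => `[< W `&` Q !=set0 >]) s.
have [m] := ubnP (n Y).
suff : forall Q Q', closed Q -> closed Q' -> Y = Q `|` Q' -> Q `&` Q' = set0 ->
    Q e -> (n Q < m)%N -> exists K, [/\ closed K, connected K, (K°) e & K `<=` Y].
  move=> h; apply: (h Y set0) => //; first exact: closed0.
  - by rewrite setU0.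
  - by rewrite setI0.
  - exact: interior_subset.
elim: m => // m IH Q Q' cQ cQ' YQ QQ' Qe; rewrite ltnS => nQ.
have QY : Q `<=` Y by rewrite YQ; exact: subsetUl.
have [coQ|/(connected_closedP cQ)] := pselect (connected Q).
  exists Q; split => //.
  have : nbhs e (~` Q').
    apply: open_nbhs_nbhs; split; first exact: closed_openC.
    by move=> Q'e; have : set0 e by rewrite -QQ'.
  move=> Q'e; near=> z; have : Y z by near: z.
  by rewrite YQ => -[//|]; have : ~ Q' z by near: z.
move=> /existsNP[B] /existsNP[C]; rewrite !not_implyE => -[cB [cC [QBC [BC0]]]].
move=> /not_orP[/eqP/set0P B0 /eqP/set0P C0].
wlog Be : B C cB cC QBC BC0 B0 C0 / B e.
  move=> h; have : Q e by []. rewrite QBC => -[Be|Ce]; first exact: (h B C).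
  by apply: (h C B) => //; rewrite 1?setUC 1?setIC.
apply: (IH B (C `|` Q')) => //; [exact: closedU| |  |].
- by rewrite setUA -QBC.
- rewrite setIUr BC0 set0U -subset0 => x [Bx Q'x]; rewrite -QQ'; split => //.
  by rewrite QBC; left.
(* [C] is clopen in [Y], so some member [W] of [s] meets it and, being connected, lies in it. This
   [W] meets [Q] but not [B], so the count drops when [Q] is replaced by [B]. *)
have [|||||W sWi WC] := meet C (B `|` Q') => //; first exact: closedU.
- by rewrite setUA (setUC C) -QBC.
- rewrite setIUr setIC BC0 set0U -subset0 => x [Cx Q'x]; rewrite -QQ'.
  by split => //; rewrite QBC; right.
have [coW WY] := sW W sWi.
have WC' : W `<=` C.
  apply: (@connected_subset_clopen _ _ (B `|` Q')) => //; first exact: closedU.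
    by apply: subset_trans WY _; rewrite setUA (setUC C) -QBC -YQ.
  rewrite setIUr setIC BC0 set0U -subset0 => x [Cx Q'x]; rewrite -QQ'.
  by split => //; rewrite QBC; right.
apply: leq_trans nQ; rewrite /n.
have sub : forall Z, `[< Z `&` B !=set0 >] -> `[< Z `&` Q !=set0 >].
  move=> Z /asboolP[z [Zz Bz]]; apply/asboolP; exists z.
  by split => //; rewrite QBC; left.
apply: (sub_count_lt sWi sub).
  by apply/asboolP => -[z [/WC' Cz Bz]]; have : set0 z by rewrite -BC0.
by apply/asboolP; case: WC => z [Wz Cz]; exists z; split => //; rewrite QBC; right.
Unshelve. all: by end_near. Qed.
End topology.

(** * Properties of Jones' function on an arbitrary continuum *)

Section jones.
Set Implicit Arguments.
Unset Strict Implicit.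
Context (R : realType) (X : metricType R) (cX : continuum [set: X]).
Implicit Types (A B K O U V W : set X) (x y z e : X).

Local Notation T := (@jonesT R X).

Lemma continuum_closed_compact A : closed A -> compact A.
Proof. by case: cX => + _ _ cA => /subclosed_compact; exact. Qed.

Lemma metric_compact_closed A : compact A -> closed A.
Proof. by apply: compact_closed; exact: metric_hausdorff. Qed.

Lemma continuum_normal A B : closed A -> closed B -> A `&` B = set0 ->
  exists U V, [/\ open U, open V, A `<=` U, B `<=` V & U `&` V = set0].
Proof.
move: A B; apply: (proj1 (@normal_openP R _)).
by apply: compact_normal; [exact: metric_hausdorff | case: cX].
Qed.

Lemma jonesTPn A x : ~ T A x <->
  exists W, [/\ continuum W, (W°) x & W `<=` ~` A].
Proof. by split => [/contrapT|WA /(_ WA)]. Qed.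

Lemma jonesTS A B : A `<=` B -> T A `<=` T B.
Proof.
move=> AB x TAx [W [cW Wx WB]]; apply: TAx; exists W; split => // z /WB Bz /AB.
exact: Bz.
Qed.

Lemma jonesT0 : T set0 = set0.
Proof.
rewrite -subset0 => x; apply; exists [set: X]; split => //.
by rewrite interiorT.
by rewrite setC0.
Qed.

Lemma jonesT_notin A W x : continuum W -> W `<=` ~` A -> (W°) x -> ~ T A x.
Proof. by move=> cW WA Wx; apply/jonesTPn; exists W. Qed.

Lemma jonesTC_cover A B : closed B -> B `&` T A = set0 ->
  exists s : seq (set X), (forall W, W \in s -> continuum W /\ W `<=` ~` A) /\
    B `<=` \bigcup_(W in [set` s]) W°.
Proof.
move=> cB BA.
have [|s [sA Bs]] := @compact_finite_cover X _
    [set W | continuum W /\ W `<=` ~` A] interior B (continuum_closed_compact cB).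
  move=> x Bx; have /jonesTPn[W [cW Wx WA]] : ~ T A x.
    by move=> Ax; have : set0 x by rewrite -BA.
  by exists W => //; apply: open_nbhs_nbhs; split => //; exact: open_interior.
by exists s.
Qed.

Lemma continuum_seq_closed (s : seq (set X)) :
  (forall W, W \in s -> continuum W) -> closed (\bigcup_(W in [set` s]) W).
Proof.
move=> sc; apply: closed_bigcup; first exact: finite_seq.
by move=> W /= /sc[+ _ _]; exact: metric_compact_closed.
Qed.

(** Upper semicontinuity needs no continuity of T: finitely many continua missing [A] cover the
    complement of [O], and they keep working for every set that misses their union. *)
Lemma jonesT_usc A O : open O -> T A `<=` O ->
  exists U, [/\ open U, A `<=` U & forall B, B `<=` U -> T B `<=` O].
Proof.
move=> oO AO; have [||s [sA Os]] := @jonesTC_cover A (~` O).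
- exact: open_closedC.
- by rewrite setIC; apply/disjoints_subset; rewrite setCK.
exists (~` \bigcup_(W in [set` s]) W); split.
- by apply/closed_openC/continuum_seq_closed => W /sA[].
- by move=> x Ax [W /sA[_ WA] Wx]; exact: WA Wx Ax.
move=> B Bs x Bx; apply: contrapT => Ox; have [W sW Wx] := Os x Ox.
have [cW _] := sA W sW; apply: jonesT_notin cW _ Wx Bx => z Wz Bz.
by apply: (Bs z Bz); exists W.
Qed.

Lemma jonesT1_usc x O : open O -> T [set x] `<=` O ->
  \forall y \near x, T [set y] `<=` O.
Proof.
move=> oO xO; have [U [oU xU UO]] := jonesT_usc oO xO.
have : nbhs x U by apply: open_nbhs_nbhs; split => //; exact: xU.
by apply: filterS => y Uy; apply: UO => _ ->.
Qed.

(** If T of a union is covered by disjoint open sets around the two pieces, its part near [A1] is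
    already due to [A1]. Otherwise a continuum neighbourhood [P] of [e] missing [A1] is cut off
    along [O2] and patched with continua missing both sets, which gives a connected neighbourhood of
    [e] missing [A1] and [A2]. *)
Lemma jonesT_split A1 A2 O1 O2 : open O1 -> open O2 -> O1 `&` O2 = set0 ->
  A1 `<=` O1 -> A2 `<=` O2 -> T (A1 `|` A2) `<=` O1 `|` O2 ->
  T (A1 `|` A2) `&` O1 `<=` T A1.
Proof.
move=> oO1 oO2 O12 AO1 AO2 AO e [Ae O1e].
apply: contrapT => /jonesTPn[P [[cP coP P0] Pe PA1]].
have O1P x : O1 x -> ~ O2 x by move=> ? ?; have : set0 x by rewrite -O12.
have PA x : P x -> ~ O2 x -> ~ (A1 `|` A2) x.
  by move=> Px O2x [/(PA1 x Px)//|/AO2].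
have [|//|s [sA Bs]] := @jonesTC_cover (A1 `|` A2) (~` (O1 `|` O2)).
- exact/open_closedC/openU.
- by rewrite setIC; apply/disjoints_subset; rewrite setCK.
pose S := \bigcup_(W in [set` s]) W.
have cS : closed S by apply: continuum_seq_closed => W /sA[].
have cPX := metric_compact_closed cP.
pose Y := (P `&` ~` O2) `|` S.
have cY : closed Y by apply: closedU => //; apply: closedI => //; exact: open_closedC.
have YA : Y `<=` ~` (A1 `|` A2).
  by move=> x [[Px O2x]|[W /sA[_ WA] Wx]]; [exact: PA | exact: WA].
have [|W sW|Q Q' cQ cQ' YQ QQ' [q Qq]|K [cK coK Ke KY]] :=
  @connected_nbhs_finite X Y s e cY.
- have : nbhs e (P° `&` O1).
    by apply: open_nbhs_nbhs; split => //; apply: openI => //; exact: open_interior.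
  by apply: filterS => x [/interior_subset Px /O1P O2x]; left.
- have [[_ coW _] _] := sA W sW; split => // x Wx; right; by exists W.
- apply: contrapT => nmeet.
  have QS x : Q x -> ~ S x.
    by move=> Qx [W sW Wx]; apply: nmeet; exists W => //; exists x.
  have QPO x : Q x -> P x /\ O1 x.
    move=> Qx; have : Y x by rewrite YQ; left.
    move=> [[Px O2x]|/(QS x Qx)//]; split => //.
    apply: contrapT => O1x; have [|W] := Bs x; first by move=> [].
    by move=> sW /interior_subset Wx; apply: (QS x Qx); exists W.
  (* A clopen part [Q] of [Y] that touches no patch lies in [O1], hence is clopen in [P] and
     contains [P]. Then [P] itself avoids [O2], so it misses [A2] as well. *)
  have PQ : P `<=` Q.
    apply: (@connected_subset_clopen X P Q (Q' `&` P `|` P `&` ~` O1)) => //.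
    + apply: closedU; first exact: closedI.
      by apply: closedI => //; exact: open_closedC.
    + move=> x Px; have [xO1|xO1] := pselect (O1 x); last by right; right.
      have : Y x by left; split => //; exact: O1P.
      by rewrite YQ => -[]; [left | right; left].
    + rewrite setIUr -subset0 => x [[Qx [Q'x _]]|[/QPO[_ ?] [_ //]]].
      by rewrite -QQ'.
    + by exists q; split => //; have [] := QPO q Qq.
  apply: Ae; exists P; split => // x /[dup] /PQ /QPO[Px O1x] _.
  by apply: PA => //; exact: O1P.
apply: Ae; exists K; split => //; last exact: subset_trans YA.
by split => //; [exact: continuum_closed_compact | exists e; exact: interior_subset].
Qed.

Lemma jonesT_split_closed A1 A2 F1 F2 : closed F1 -> closed F2 ->
  F1 `&` F2 = set0 -> A1 `<=` F1 -> A2 `<=` F2 ->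
  T (A1 `|` A2) `<=` F1 `|` F2 -> T (A1 `|` A2) `&` F1 `<=` T A1.
Proof.
move=> cF1 cF2 F12 AF1 AF2 AF.
have [U1 [U2 [oU1 oU2 FU1 FU2 U12]]] := continuum_normal cF1 cF2 F12.
apply: subset_trans (@jonesT_split A1 A2 U1 U2 oU1 oU2 U12 _ _ _).
- exact: setIS.
- exact: subset_trans FU1.
- exact: subset_trans FU2.
- by apply: subset_trans AF _; exact: setUSS.
Qed.

(** The case [A1 = set0] of the splitting, where T is empty: a nonempty clopen part of [T A] cannot
    miss [A]. *)
Lemma jonesT_component_meets A F1 F2 : closed F1 -> closed F2 ->
  F1 `&` F2 = set0 -> A `<=` F2 -> T A `<=` F1 `|` F2 -> T A `&` F1 = set0.
Proof.
move=> cF1 cF2 F12 AF2 AF; rewrite -subset0 -jonesT0.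
by have := @jonesT_split_closed set0 A F1 F2 cF1 cF2 F12; rewrite set0U; apply.
Qed.

Lemma connected_jonesT1 x : connected (T [set x]).
Proof.
apply/(connected_closedP (@jonesT_closed R X [set x])) => B C cB cC TBC BC0.
wlog Cx : B C cB cC TBC BC0 / C x.
  move=> h; have : T [set x] x by exact: subset_jonesT.
  rewrite TBC => -[Bx|Cx]; last exact: h.
  by apply/or_comm; apply: h; rewrite 1?setUC 1?setIC.
left; rewrite -subset0 => y By.
have <- : T [set x] `&` B = set0.
  apply: (@jonesT_component_meets _ B C) => //; first by move=> _ ->.
  by rewrite TBC.
by split => //; rewrite TBC; left.
Qed.

End jones.

(** * Lower semicontinuity and idempotence *)

Section continuous_jones.
Set Implicit Arguments.
Unset Strict Implicit.
Context (R : realType) (X : metricType R) (cX : continuum [set: X]).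
Context (contT : continuous (jonesT_hyperspace cX)).
Implicit Types (A B K O U V W : set X) (x y z e : X) (d : R).

Local Notation T := (@jonesT R X).

Lemma metric_closed_seq (s : seq X) : closed [set` s].
Proof.
apply: (proj1 accessible_finite_set_closed _ _ (finite_seq s)).
by apply: hausdorff_accessible; exact: metric_hausdorff.
Qed.

Lemma metric_closed1 x : closed [set x].
Proof.
by apply: accessible_closed_set1; apply: hausdorff_accessible; exact: metric_hausdorff.
Qed.

Lemma subset_set_nbhd d A B : (0 < d)%R -> A `<=` B -> A `<=` set_nbhd d B.
Proof. by move=> d0 AB x /AB Bx; exists x => //; exact: ballxx. Qed.

Lemma jonesT_lsc A O : closed A -> A !=set0 -> open O -> T A `&` O !=set0 ->
  exists d, (0 < d)%R /\ forall B, closed B -> B !=set0 ->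
    A `<=` set_nbhd d B -> B `<=` set_nbhd d A -> T B `&` O !=set0.
Proof.
move=> cA A0 oO [x [Ax Ox]].
have /nbhs_ballP[e /= e0 xeO] : nbhs x O by exact: open_nbhs_nbhs.
pose A' := Hyperspace cX cA A0.
have /nbhs_ballP[d /= d0 dA] := contT (nbhsx_ballx (jonesT_hyperspace cX A') e e0).
(* Mutual inclusion in neighbourhoods bounds the Hausdorff distance only weakly, whereas the ball of
   radius [d] asks for a strict inequality. *)
exists (d / 2)%R; split; first by lra.
move=> B cB B0 AB BA; pose B' := Hyperspace cX cB B0.
have : ball A' d B'.
  rewrite ballEmdist /=; apply: (@le_lt_trans _ _ (d / 2)%R); last by lra.
  by apply: hausdorff_dist_le => //; lra.
move=> /dA; rewrite /= ballEmdist /= => /hausdorff_dist_lt[e' e'e [e'0 + _]].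
move=> /(_ x Ax)[y By /ball_sym xy]; exists y; split => //.
by apply: xeO; apply: le_ball xy; exact: ltW.
Qed.

Lemma continuum_finite_dense A Y d : closed A -> Y `<=` A -> A `<=` closure Y ->
  (0 < d)%R -> exists s : seq X, [set` s] `<=` Y /\ A `<=` set_nbhd d [set` s].
Proof.
move=> cA YA AY d0.
have cptA : compact A by case: cX => + _ _; move/(subclosed_compact cA); exact.
have [x /AY|s [sY As]] := @compact_finite_cover X X Y (fun y => ball y d) A cptA.
  move=> /(_ (ball x (d / 2))%R)[|y [Yy xy]].
    by apply: nbhsx_ballx; lra.
  exists y => //; apply/nbhs_ballP; exists (d / 2)%R => /=; first by lra.
  move=> z xz; rewrite (_ : d = d / 2 + d / 2)%R; last by lra.
  exact: ball_triangle (ball_sym xy) xz.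
by exists s; split => // y /sY.
Qed.

Lemma jonesT_dense A Y O : closed A -> A !=set0 -> Y `<=` A ->
  A `<=` closure Y -> open O -> T A `&` O !=set0 ->
  exists s : seq X, [set` s] `<=` Y /\ T [set` s] `&` O !=set0.
Proof.
move=> cA A0 YA AY oO AO.
have [d [d0 dP]] := jonesT_lsc cA A0 oO AO.
have [s [sY As]] := continuum_finite_dense cA YA AY d0.
exists s; split => //; apply: dP; [exact: metric_closed_seq | | exact: As |].
  by have [a /As[y sy _]] := A0; exists y.
by apply: subset_set_nbhd => //; exact: subset_trans YA.
Qed.

Lemma jonesT1_lsc x B O : closed B -> open O -> T ([set x] `|` B) `&` O !=set0 ->
  \forall y \near x, T ([set y] `|` B) `&` O !=set0.
Proof.
move=> cB oO TO.
have cU z : closed ([set z] `|` B).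
  by apply: closedU => //; exact: metric_closed1.
have U0 z : [set z] `|` B !=set0 by exists z; left.
have [d [d0 dP]] := jonesT_lsc (cU x) (U0 x) oO TO.
apply/nbhs_ballP; exists d => //= y xy; apply: dP => //.
  move=> z [->|Bz]; first by exists y; [left | exact: ball_sym].
  by exists z; [right | exact: ballxx].
move=> z [->|Bz]; first by exists x; [left |].
by exists z; [right | exact: ballxx].
Qed.

(** It suffices to treat the complement of the interior of [K], which is the closure of the
    complement of [K]. Finite sets outside [K] approximate it, and for them [K] itself witnesses
    that T avoids the interior of [K]. *)
Lemma jonesT_interior K A : continuum K -> A `&` K° = set0 -> T A `&` K° = set0.
Proof.
move=> cK AK; rewrite -subset0 => e [Ae Ke].
have AF : A `<=` ~` K° by apply/disjoints_subset.
have Fe : T (~` K°) e by exact: jonesTS Ae.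
have [F0|F0] := pselect (~` K° !=set0); last first.
  by move: Fe; rewrite (proj1 (nonemptyPn _) F0) (jonesT0 cX).
have [||||||s [sK [y [sy Ky]]]] := @jonesT_dense (~` K°) (~` K) K° => //.
- by apply: open_closedC; exact: open_interior.
- by apply: subsetC; exact: interior_subset.
- by rewrite closure_setC.
- exact: open_interior.
- by exists e.
by apply: jonesT_notin cK _ Ky sy => z Kz /sK.
Qed.

Lemma jonesT_shrink K e : continuum K -> (K°) e ->
  exists L, [/\ continuum L, (L°) e & L `<=` K°].
Proof.
move=> cK Ke.
have /jonesTPn[L [cL Le]] : ~ T (~` K°) e.
  move=> Te; have : set0 e by rewrite -(@jonesT_interior K (~` K°)) // setICl.
  by [].
by rewrite setCK => LK; exists L.
Qed.

Lemma jonesT_idem A : T (T A) `<=` T A.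
Proof.
move=> e TTe [W [cW We WA]]; apply: TTe.
have [L [cL Le LW]] := jonesT_shrink cW We.
by exists L; split => // z /LW Wz; exact: jonesT_notin cW WA Wz.
Qed.

Lemma jonesT_sub A B : A `<=` T B -> T A `<=` T B.
Proof. by move=> /jonesTS; move/subset_trans; apply; exact: jonesT_idem. Qed.

Lemma jonesT1_sub A y : T A y -> T [set y] `<=` T A.
Proof. by move=> Ay; apply: jonesT_sub => _ ->. Qed.

End continuous_jones.

(** * Symmetry of T on points *)

Section point_symmetry.
Set Implicit Arguments.
Unset Strict Implicit.
Context (R : realType) (X : metricType R) (cX : continuum [set: X]).
Context (contT : continuous (jonesT_hyperspace cX)).
Implicit Types (A B K O U V W : set X) (x y z e : X) (d : R).

Local Notation T := (@jonesT R X).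

Lemma jonesT1_self x : T [set x] x.
Proof. exact: subset_jonesT. Qed.

Lemma jonesT1_lsc0 x O : open O -> T [set x] `&` O !=set0 ->
  \forall y \near x, T [set y] `&` O !=set0.
Proof.
move=> oO; have := @jonesT1_lsc _ _ _ contT x _ O closed0 oO; rewrite setU0.
by move=> /[apply]; apply: filterS => y; rewrite setU0.
Qed.

(** By idempotence, [T [set x] y] is a preorder in [x] and [y]. The points selected are those whose
    set [T [set x]] is minimal for inclusion among the sets T of points. *)
Definition jonesT_minimal := [set x : X | forall y, T [set x] y -> T [set y] x].
Local Notation D := jonesT_minimal.

Lemma jonesT_minimal_sub x : D x -> T [set x] `<=` D.
Proof.
move=> Dx y xy z yz; apply: (jonesT1_sub contT (A := [set z]) _ xy).
by apply: Dx; exact: (jonesT1_sub contT xy).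
Qed.

Lemma jonesT_minimal_meets x : exists y, T [set x] y /\ D y.
Proof.
pose S := {y | T [set x] y}.
pose r (y z : S) := `[< T [set sval y] (sval z) >].
have [||A totA|[m xm] mmax] := @ZL_preorder S (exist _ x (@jonesT1_self x)) r.
- by move=> y; apply/asboolP; exact: jonesT1_self.
- move=> y z w /asboolP yz /asboolP zw; apply/asboolP.
  exact: (jonesT1_sub contT yz).
- have [[a Aa]|A0] := pselect (A !=set0); last first.
    by exists (exist _ x (@jonesT1_self x)) => s As; exfalso; apply: A0; exists s.
  (* The sets T of the points of the chain are nested and closed, so a cluster point of the filter
     they generate lies in all of them and bounds the chain. *)
  pose F := filter_from A (fun y : S => T [set sval y]).
  have FF : ProperFilter F.
    apply: filter_from_proper; last by move=> y _; exists (sval y); exact: jonesT1_self.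
    apply: filter_from_filter; first by exists a.
    move=> y z Ay Az; have [/asboolP yz|/asboolP zy] := totA y z Ay Az.
      by exists z => // w zw; split => //; exact: (jonesT1_sub contT yz).
    by exists y => // w yw; split => //; exact: (jonesT1_sub contT zy).
  have [p [_ Fp]] : [set: X] `&` cluster F !=set0.
    by case: cX => cptX _ _; apply: cptX; exact: filterT.
  have Tp (y : S) : A y -> T [set sval y] p.
    move=> Ay; rewrite ((closure_id _).1 (@jonesT_closed R X [set sval y])).
    by move=> V pV; apply: Fp => //; exists y.
  have xp : T [set x] p by apply: (jonesT1_sub contT (svalP a)); exact: Tp.
  by exists (exist _ p xp) => y Ay; apply/asboolP; exact: Tp.
exists m; split => // y my.
have xy : T [set x] y by exact: (jonesT1_sub contT xm).
by apply/asboolP; apply: (mmax (exist _ y xy)); apply/asboolP.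
Qed.

(** A failure of minimality persists: if [W] is a continuum neighbourhood of [x] missing some [y] in
    [T [set x]], then for [z] near [x] the set [T [set z]] still leaves [W], at a point whose T does
    not contain [z]. *)
Lemma jonesT_minimal_closed : closed D.
Proof.
rewrite -(setCK D); apply: open_closedC; rewrite openE => x.
move=> /existsNP[y] /not_implyP[xy /jonesTPn[W [cW Wx Wy]]].
have cptW : compact W by case: cW.
have oW : open (~` W).
  apply: closed_openC; apply: compact_closed => //; exact: metric_hausdorff.
have : \forall z \near x, T [set z] `&` ~` W !=set0.
  by apply: jonesT1_lsc0 => //; exists y; split => // /Wy; exact.
have : nbhs x W° by apply: open_nbhs_nbhs; split => //; exact: open_interior.
apply: filterS2 => z Wz [w [zw Ww]] Dz.
apply: (@jonesT_notin R X [set w] W z cW _ Wz (Dz w zw)) => v Wv /= vw.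
by apply: Ww; rewrite -vw.
Qed.

(* If [B] is clopen in [D], then [T [set x]] meets [B] for a clopen set of
   points [x]. *)
Lemma jonesT_minimal_connected : connected D.
Proof.
move=> B [b Bb] [C oC BC] [C' cC' BC'].
have cB : closed B.
  by rewrite BC'; apply: closedI => //; exact: jonesT_minimal_closed.
have BD : B `<=` D by rewrite BC => x [].
have DB x : D x -> T [set x] `&` B !=set0 -> T [set x] `<=` B.
  move=> Dx xB; apply: (@connected_subset_clopen X _ B (D `&` ~` C)) => //.
  - exact: connected_jonesT1.
  - by apply: closedI; [exact: jonesT_minimal_closed | exact: open_closedC].
  - move=> y /(jonesT_minimal_sub Dx) Dy; rewrite BC.
    by have [Cy|Cy] := pselect (C y); [left | right].
  - by rewrite -subset0 BC => y [[_ Cy] [_ /(_ Cy)]].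
pose S := [set x | T [set x] `&` B !=set0].
(* Near [x], T of a point reaches some [w] close to [y]. A minimal point of [T [set w]] lies in [C]
   by upper semicontinuity, hence in [B]. *)
have S_open : open S.
  rewrite openE => x [y [xy By]].
  have yC : T [set y] `<=` C.
    apply: subset_trans (DB y (BD y By) _) _; last by rewrite BC => z [].
    by exists y; split => //; exact: jonesT1_self.
  have [U [oU yU UC]] : exists U, [/\ open U, U y & forall z, U z -> T [set z] `<=` C].
    have : nbhs y [set z | T [set z] `<=` C] by exact: jonesT1_usc.
    by rewrite nbhsE => -[U [oU Uy] UC]; exists U.
  have : \forall z \near x, T [set z] `&` U !=set0.
    by apply: jonesT1_lsc0 => //; exists y.
  apply: filterS => z [w [zw Uw]]; have [v [wv Dv]] := jonesT_minimal_meets w.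
  exists v; split; first exact: (jonesT1_sub contT zw).
  by rewrite BC; split => //; exact: (UC w).
have S_closed : closed S.
  rewrite -(setCK S); apply: open_closedC; rewrite openE => x Sx.
  have xB : T [set x] `<=` ~` B by move=> y xy By; apply: Sx; exists y.
  have : \forall z \near x, T [set z] `<=` ~` B.
    by apply: jonesT1_usc => //; exact: closed_openC.
  by apply: filterS => z zB [w [/zB]].
have ST : S = [set: X].
  have b_in : S b by exists b; split => //; exact: jonesT1_self.
  case: cX => _ coX _; apply: coX; first by exists b.
  - by exists S => //; rewrite setTI.
  - by exists S => //; rewrite setTI.
apply/seteqP; split => // x Dx; apply: (DB x Dx); last exact: jonesT1_self.
by have : S x by rewrite ST.
Qed.

Lemma jonesT_minimalT : D = [set: X].
Proof.
apply/seteqP; split => // a _; have [b [ab Db]] := jonesT_minimal_meets a.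
apply: contrapT => Da.
have : ~ T [set b] a by move=> /(jonesT_minimal_sub Db).
move=> /jonesTPn[W [cW Wa Wb]].
have oW : open (~` W).
  apply: closed_openC; apply: compact_closed; first exact: metric_hausdorff.
  by case: cW.
pose K := closure (\bigcup_(y in ~` W) (D `|` T [set y])).
have Wb' : ~ W b by move=> /Wb; exact.
have Ka : ~ K a.
  have : nbhs a (W° `&` ~` D).
    apply: open_nbhs_nbhs; split => //; apply: openI; first exact: open_interior.
    by apply: closed_openC; exact: jonesT_minimal_closed.
  move=> aW /(_ _ aW)[z [[y Wy [Dz|yz]] [Wz NDz]]]; first by [].
  apply: (@jonesT_notin R X [set y] W z cW _ Wz yz) => v Wv /= vy.
  by apply: Wy; rewrite -vy.
suff KP : [/\ continuum K, (K°) b & K `<=` ~` [set a]].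
  by apply: ab; exists K.
split.
- split.
  + case: cX => cptX _ _; apply: subclosed_compact cptX _ => //.
    exact: closed_closure.
  + apply: connected_closure; apply: bigcup_connected.
      by exists b => y _; left.
    move=> y _; apply: connectedU.
    * by have [z [yz Dz]] := jonesT_minimal_meets y; exists z.
    * exact: jonesT_minimal_connected.
    * exact: connected_jonesT1.
  + by exists b; apply: subset_closure; exists b => //; left.
- have : nbhs b (~` W) by apply: open_nbhs_nbhs; split.
  apply: filterS => y Wy; apply: subset_closure; exists y => //; right.
  exact: jonesT1_self.
- by move=> z Kz za; apply: Ka; rewrite -za.
Qed.

Lemma jonesT1_sym x y : T [set x] y -> T [set y] x.
Proof. by suff Dx : D x; [exact: Dx | rewrite jonesT_minimalT]. Qed.

End point_symmetry.

(** * Additivity on finite sets, then on closed sets *)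

Section additivity.
Set Implicit Arguments.
Unset Strict Implicit.
Context (R : realType) (X : metricType R) (cX : continuum [set: X]).
Context (contT : continuous (jonesT_hyperspace cX)).
Implicit Types (A B C K O U V W : set X) (x y z e : X) (d : R) (s : seq X).

Local Notation T := (@jonesT R X).

(** The reverse inclusion is monotonicity, so this amounts to additivity for the pair. *)
Definition jonesT_splits A B := T (A `|` B) `<=` T A `|` T B.

Lemma jonesT_splitsC A B : jonesT_splits A B -> jonesT_splits B A.
Proof. by rewrite /jonesT_splits setUC (setUC (T A)). Qed.

(** Disjoint open sets around the two values of T still cover T of the union after a small move of
    [x], by upper semicontinuity, and [jonesT_split] then separates the two parts. *)
Lemma jonesT_splits_near x B C : T ([set x] `|` B) `&` T C = set0 ->
  jonesT_splits ([set x] `|` B) C ->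
  \forall y \near x, jonesT_splits ([set y] `|` B) C.
Proof.
set A := [set x] `|` B => AC sAC.
have [U1 [U2 [oU1 oU2 AU1 CU2 U12]]] :=
  continuum_normal cX (@jonesT_closed R X A) (@jonesT_closed R X C) AC.
have [||U [oU ACU UP]] := @jonesT_usc R X cX (A `|` C) (U1 `|` U2).
- exact: openU.
- by apply: subset_trans sAC _; exact: setUSS.
have AU1' : A `<=` U1 by apply: subset_trans AU1; exact: subset_jonesT.
have CU2' : C `<=` U2 by apply: subset_trans CU2; exact: subset_jonesT.
have : nbhs x (U `&` U1).
  apply: open_nbhs_nbhs; split; first exact: openI.
  by split; [apply: ACU; left; left | apply: AU1'; left].
apply: filterS => y [Uy U1y] z yz.
have AU1y : [set y] `|` B `<=` U1.
  by move=> w [->//|Bw]; apply: AU1'; right.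
have yzU : ([set y] `|` B) `|` C `<=` U.
  by move=> w [[->//|Bw]|Cw]; apply: ACU; [left; right | right].
have [U1z|U2z] := UP _ yzU z yz.
  left; apply: (jonesT_split cX oU1 oU2 U12 AU1y CU2' _ (conj yz U1z)).
  exact: UP.
right; apply: (jonesT_split cX oU2 oU1 _ CU2' AU1y).
- by rewrite setIC.
- by rewrite setUC (setUC U2); exact: UP.
- by rewrite setUC; split.
Qed.

(** A point [p] violating the inclusion has continuum neighbourhoods [W1] and [W2] missing the two
    sets. By lower semicontinuity T of the moved union still meets both interiors, and [W1] still
    misses the moved set. *)
Lemma jonesT_nsplits_near x B C : closed B -> closed C ->
  ~ jonesT_splits ([set x] `|` B) C ->
  \forall y \near x, ~ jonesT_splits ([set y] `|` B) C.
Proof.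
move=> cB cC /existsNP[p] /not_implyP[xp /not_orP[]].
move=> /jonesTPn[W1 [cW1 W1p W1x]] /jonesTPn[W2 [cW2 W2p W2C]].
have W1x' : nbhs x (~` W1).
  apply: open_nbhs_nbhs; split; last by move=> /W1x; apply; left.
  by apply: closed_openC; apply: metric_compact_closed; case: cW1.
have near_x : \forall y \near x, T ([set y] `|` (B `|` C)) `&` (W1° `&` W2°) !=set0.
  apply: (jonesT1_lsc contT (closedU cB cC)).
    by apply: openI; exact: open_interior.
  by exists p; rewrite setUA.
apply: filterS2 near_x W1x' => y [q [+ [W1q W2q]]] W1y.
rewrite setUA => yq /(_ q yq)[].
  apply: (@jonesT_notin R X _ W1 q cW1 _ W1q) => z W1z [zy|Bz].
    by apply: W1y; rewrite -zy.
  by apply: (W1x z W1z); right.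
exact: (@jonesT_notin R X _ W2 q cW2 W2C W2q).
Qed.

(** If no such [y] existed in [U], the failing points outside [T [set e]] would form a clopen set:
    [U] keeps them away from [T [set e]], and elsewhere both the equation and its failure are open.
    Being nonempty, this set would be all of X, yet it omits [e]. *)
Lemma jonesT_nsplits_move e B U : closed B -> open U -> T [set e] `<=` U ->
  (forall y, ~ T [set e] y -> T ([set y] `|` B) `&` T [set e] = set0) ->
  forall x, ~ T [set e] x -> ~ jonesT_splits ([set x] `|` B) [set e] ->
  exists y, [/\ U y, ~ T [set e] y & ~ jonesT_splits ([set y] `|` B) [set e]].
Proof.
move=> cB oU eU disj x ex nx; apply: contrapT => none.
pose S := [set y | ~ T [set e] y /\ ~ jonesT_splits ([set y] `|` B) [set e]].
have oTe : open (~` T [set e]) by apply: closed_openC; exact: jonesT_closed.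
have closed_e : closed [set e] by exact: metric_closed1.
have S_open : open S.
  rewrite openE => y [ey ny].
  apply: filterS2 (jonesT_nsplits_near cB closed_e ny) (open_nbhs_nbhs (conj oTe ey)).
  by move=> z nz ez; split.
have S_closed : closed S.
  rewrite -(setCK S); apply: open_closedC; rewrite openE => y Sy.
  have [ey|ey] := pselect (T [set e] y).
    have : nbhs y U by apply: open_nbhs_nbhs; split => //; exact: eU.
    by apply: filterS => z Uz [ez nz]; apply: none; exists z.
  have sy : jonesT_splits ([set y] `|` B) [set e] by apply: contrapT => ny; exact: Sy.
  by apply: filterS (jonesT_splits_near (disj y ey) sy) => z sz [_].
have ST : S = [set: X].
  case: cX => _ coX _; apply: coX; first by exists x.
  - by exists S => //; rewrite setTI.
  - by exists S => //; rewrite setTI.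
by have [] : S e; [rewrite ST | move=> /(_ (@jonesT1_self R X e))].
Qed.

Lemma set_consU x s : [set` x :: s] = [set x] `|` [set` s].
Proof.
apply/seteqP; split => y /=; rewrite inE.
  by move=> /orP[/eqP ->|ys]; [left | right].
by move=> [->|ys]; rewrite ?eqxx// ys orbT.
Qed.

Definition jonesT_union_size n := forall s, size s = n ->
  T [set` s] `<=` \bigcup_(x in [set` s]) T [set x].

(** The points of [s1] remain to be moved and those of [s2] already lie in [U]. The total length
    stays [n], so the union formula for lists of length [n], with symmetry on points, supplies the
    disjointness required for each move. *)
Lemma jonesT_nsplits_move_all n e U :
  jonesT_union_size n -> open U -> T [set e] `<=` U ->
  forall s1 s2, (size s1 + size s2 = n)%N ->
  (forall x, x \in s1 ++ s2 -> ~ T [set e] x) -> [set` s2] `<=` U ->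
  ~ jonesT_splits [set` s1 ++ s2] [set e] ->
  exists s, [set` s] `<=` U /\ ~ jonesT_splits [set` s] [set e].
Proof.
move=> Pn oU eU; elim=> [|x s1 IH] s2 sz es sU ns; first by exists s2.
have [|y ey|||y [Uy ey ny]] := @jonesT_nsplits_move e [set` s1 ++ s2] U _ oU eU _ x.
- exact: metric_closed_seq.
- rewrite -set_consU -subset0 => z [/Pn + ez] => -[|w]; first by rewrite /= size_cat.
  rewrite /= inE => /orP[/eqP -> yz|ws wz].
    by apply: ey; apply: (jonesT1_sub contT ez); exact: (jonesT1_sym contT).
  apply: (es w); first by rewrite inE ws orbT.
  by apply: (jonesT1_sub contT ez); exact: (jonesT1_sym contT).
- by apply: es; exact: mem_head.
- by rewrite -set_consU.
have E : [set` s1 ++ y :: s2] = [set y] `|` [set` s1 ++ s2].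
  rewrite -set_consU; apply/seteqP.
  by split => z /=; rewrite !(inE, mem_cat) orbCA.
apply: (IH (y :: s2)).
- by rewrite /= addnS -sz.
- move=> z; have := E; move/seteqP => [/(_ z) + _] => /[apply] -[->//|zs].
  by apply: es; rewrite inE zs orbT.
- by rewrite set_consU => z [->//|/sU].
- by rewrite E.
Qed.

Lemma jonesT_union_sizeS n : jonesT_union_size n -> jonesT_union_size n.+1.
Proof.
move=> Pn [//|x r] [szr] e xre; apply: contrapT => nU.
have nT y : y \in x :: r -> ~ T [set e] y.
  by move=> yr ey; apply: nU; exists y => //; exact: (jonesT1_sym contT).
have ex : ~ T [set e] x by apply: nT; exact: mem_head.
move: xre; rewrite set_consU; set A := [set` r] => xre.
have cA : closed A by exact: metric_closed_seq.
have eA : ~ T A e.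
  move=> /(Pn r szr)[y yr ye]; apply: nU; exists y => //.
  by rewrite /= inE [_ \in r]yr orbT.
have xA : ~ T A x.
  move=> Ax; apply: eA; apply: (jonesT_sub contT _ xre) => y [->//|].
  exact: subset_jonesT.
have nx : ~ jonesT_splits [set x] A.
  by move=> /(_ e xre)[xe|//]; apply: ex; exact: (jonesT1_sym contT).
have disjA z : ~ T A z -> T ([set z] `|` set0) `&` T A = set0.
  move=> Az; rewrite setU0 -subset0 => w [zw Aw]; apply: Az.
  by apply: (jonesT1_sub contT Aw); exact: (jonesT1_sym contT).
have oTA : open (~` T A) by apply: closed_openC; exact: jonesT_closed.
(* Outside [T A] the equation is clopen in the first point. If it held at [e], it would hold
   throughout a continuum neighbourhood [P] of [e] missing [T A]; then [P] would omit [x],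
   contradicting [xre]. *)
have ne : ~ jonesT_splits [set e] A.
  move=> se.
  have /jonesTPn[P [[cptP coP P0] Pe PA]] : ~ T (T A) e.
    by move=> /(jonesT_idem contT).
  have cP : closed P by exact: metric_compact_closed.
  pose G1 := [set z | ~ T A z /\ jonesT_splits [set z] A].
  pose G2 := [set z | ~ T A z /\ ~ jonesT_splits [set z] A].
  have oG1 : open G1.
    rewrite openE => z [Az sz].
    have near_z : \forall y \near z, jonesT_splits ([set y] `|` set0) A.
      by apply: jonesT_splits_near; [exact: disjA | rewrite setU0].
    apply: filterS2 near_z (open_nbhs_nbhs (conj oTA Az)) => y.
    by rewrite setU0.
  have oG2 : open G2.
    rewrite openE => z [Az sz].
    have near_z : \forall y \near z, ~ jonesT_splits ([set y] `|` set0) A.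
      by apply: jonesT_nsplits_near; [exact: closed0 | | rewrite setU0].
    apply: filterS2 near_z (open_nbhs_nbhs (conj oTA Az)) => y.
    by rewrite setU0.
  have PG : P `<=` P `&` ~` G2.
    apply: (@connected_subset_clopen X _ _ (P `&` ~` G1)) => //.
    - by apply: closedI => //; exact: open_closedC.
    - by apply: closedI => //; exact: open_closedC.
    - move=> z Pz; have [sz|nz] := pselect (jonesT_splits [set z] A).
        by left; split => // -[].
      by right; split => // -[].
    - rewrite -subset0 => z [[Pz G2z] [_ G1z]].
      have Az := PA z Pz; have [sz|nz] := pselect (jonesT_splits [set z] A).
        by apply: G1z.
      by apply: G2z.
    - exists e; split; first exact: interior_subset.
      by split; [exact: interior_subset | move=> -[]].
  have Px : ~ P x by move=> /PG[_]; apply.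
  apply: (@jonesT_notin R X ([set x] `|` A) P e _ _ Pe xre) => // z Pz.
  move=> [zx|Az]; first by apply: Px; rewrite -zx.
  by apply: (PA z Pz); exact: subset_jonesT.
pose O := ~` ([set x] `|` A).
have cxA : closed ([set x] `|` A) by apply: closedU => //; exact: metric_closed1.
have eO : T (T [set e]) `<=` O.
  move=> z /(jonesT_idem contT) ez [zx|Az].
    by apply: ex; rewrite -zx.
  by apply: (nT z) ez; rewrite inE [_ \in r]Az orbT.
(* Upper semicontinuity is taken at [T [set e]] rather than at [e], since the points of [A] can only
   be moved close to that set; idempotence makes this possible. *)
have [U [oU eU UO]] := jonesT_usc cX (closed_openC cxA) eO.
have [||||s [sU ns]] := @jonesT_nsplits_move_all n e U Pn oU eU r [::].
- by rewrite addn0.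
- by rewrite cats0 => y yr; apply: nT; rewrite inE yr orbT.
- by move=> y.
- by rewrite cats0 => /jonesT_splitsC.
have cs : closed [set` s] by exact: metric_closed_seq.
pose V := [set y | U y /\ ~ jonesT_splits [set y] [set` s]].
have Ve : nbhs e V.
  have near_e : \forall y \near e, ~ jonesT_splits ([set y] `|` set0) [set` s].
    apply: jonesT_nsplits_near => //; first exact: closed0.
    by rewrite setU0 => /jonesT_splitsC.
  have Ue : nbhs e U by apply: open_nbhs_nbhs; split => //; apply: eU; exact: jonesT1_self.
  by apply: filterS2 near_e Ue => y; rewrite setU0.
(* [K] contains the neighbourhood [V] of [e] and avoids [x] and [A], so a connected closed
   neighbourhood of [e] inside [K] contradicts [xre]. *)
pose K := T (V `|` [set` s]).
have cK : closed K by exact: jonesT_closed.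
have VK : V `<=` K by move=> y Vy; apply: subset_jonesT; left.
have KO : K `<=` O by apply: UO => y [[]|/sU].
have [|W /mapP[y ys ->]|Q Q' cQ cQ' KQ QQ' [q Qq]|L [cL coL Le LK]] :=
  @connected_nbhs_finite X K [seq [set y] | y <- s] e cK.
- exact: filterS VK Ve.
- split; first exact: connected1.
  by move=> _ ->; apply: subset_jonesT; right.
(* A clopen part [Q] of [K] missing [s] must meet [V]. For [y] in both, the partition into [Q] and
   [Q'] separates [y] from [s] and forces the equation that membership in [V] denies. *)
- apply: contrapT => nmeet.
  have sQ y : y \in s -> ~ Q y.
    move=> ys Qy; apply: nmeet; exists [set y]; last by exists y.
    by apply/mapP; exists y.
  have KQ' y : K y -> ~ Q y -> Q' y by rewrite KQ => -[].
  have sQ' : [set` s] `<=` Q'.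
    by move=> y ys; apply: KQ'; [apply: subset_jonesT; right | exact: sQ].
  have [y [Vy Qy]] : V `&` Q !=set0.
    apply: contrapT => VQ.
    suff : set0 q by [].
    rewrite -(@jonesT_component_meets R X cX (V `|` [set` s]) Q Q') //.
    + by split => //; rewrite -/K KQ; left.
    + move=> y [Vy|/sQ'//]; apply: KQ'; first exact: VK.
      by move=> Qy; apply: VQ; exists y.
    + by rewrite -/K KQ.
  case: (Vy) => _; apply=> z yz.
  have yK : T ([set y] `|` [set` s]) `<=` K.
    by apply: jonesTS => w [->|sw]; [left | right].
  have := yK z yz; rewrite KQ => -[Qz|Q'z].
    left; apply: (@jonesT_split_closed R X cX [set y] [set` s] Q Q') => //.
    + by move=> _ ->.
    + by rewrite -KQ.
  right; apply: (@jonesT_split_closed R X cX [set` s] [set y] Q' Q) => //.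
  + by rewrite setIC.
  + by move=> _ ->.
  + by rewrite setUC (setUC Q') -KQ.
  + by rewrite setUC.
apply: (@jonesT_notin R X ([set x] `|` A) L e _ _ Le xre).
  split => //; first exact: continuum_closed_compact.
  by exists e; exact: interior_subset.
exact: subset_trans KO.
Qed.

Lemma jonesT_finite s : T [set` s] `<=` \bigcup_(x in [set` s]) T [set x].
Proof.
suff P n : jonesT_union_size n by exact: P.
elim: n => [|n]; last exact: jonesT_union_sizeS.
case=> // _ z; rewrite (_ : [set` [::]] = set0) ?(jonesT0 cX)//.
by rewrite -subset0 => y.
Qed.

(** If no such [x] exists, symmetry gives that [T [set z]] misses [A], and so does [T [set y]] for
    [y] near [z]. But lower semicontinuity puts such a [y] into T of a finite subset of [A], where
    the finite formula and symmetry give a contradiction. *)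
Lemma jonesT_closed_union A z : closed A -> T A z -> exists2 x, A x & T [set x] z.
Proof.
move=> cA Az; apply: contrapT => nA.
have A0 : A !=set0.
  by apply: contrapT => /nonemptyPn A0; move: Az; rewrite A0 (jonesT0 cX).
have zA : T [set z] `<=` ~` A.
  by move=> x zx Ax; apply: nA; exists x => //; exact: (jonesT1_sym contT).
have : nbhs z [set y | T [set y] `<=` ~` A].
  by apply: jonesT1_usc => //; exact: closed_openC.
rewrite nbhsE => -[U [oU Uz] UA].
have [|||s [sA [y [sy Uy]]]] := @jonesT_dense _ _ _ contT A A U cA A0 _ _ oU.
- by [].
- exact: subset_closure.
- by exists z.
have [x xs xy] := jonesT_finite sy.
by apply: (UA y Uy x); [exact: (jonesT1_sym contT) | exact: sA].
Qed.

End additivity.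

Theorem corollary3p8 (R : realType) (X : metricType R)
    (cX : continuum [set: X]) :
  continuous (jonesT_hyperspace cX) -> T_symmetric X /\ T_additive X.
Proof.
move=> contT; split=> A B cA cB.
  have disj (C C' : set X) : closed C -> C `&` jonesT C' = set0 -> closed C' ->
      jonesT C `&` C' = set0.
    move=> cC CC' cC'; rewrite -subset0 => y [Cy C'y].
    have [x Cx xy] := jonesT_closed_union contT cC Cy.
    suff : set0 x by [].
    rewrite -CC'; split=> //; apply: (jonesTS (A := [set y])); first by move=> _ ->.
    exact: (jonesT1_sym contT).
  split => [AB|AB]; first exact: disj.
  by rewrite setIC; apply: disj => //; rewrite setIC.
apply/seteqP; split=> z.
  move=> /(jonesT_closed_union contT (closedU cA cB))[x [Ax|Bx] xz]; [left|right].
    by apply: jonesTS xz => _ ->.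
  by apply: jonesTS xz => _ ->.
by move=> [|]; apply: jonesTS; [exact: subsetUl | exact: subsetUr].
Qed.
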